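(* For an integer $N\ge 2$ let $K_N$ be the maximum of $e(X)$ over all $X\subset\mathbb{S}^2$ with $|X|=N$. Let $N>2$. Then $K_N\le 3N-6$, and equality is attained for $N=3,4,6,12$ and only for these values of $N$.
   Context: $\mathbb{S}^2$ is the unit sphere in $\mathbb{R}^3$ and $\operatorname{dist}(x,y)$ is the angular distance. For a finite set $X\subset\mathbb{S}^2$, $\psi(X):=\min\{\operatorname{dist}(x,y): x,y\in X,\ x\neq y\}$, and $e(X)$ is the number of (unordered) pairs $\{x,y\}\subset X$, $x\ne y$, with $\operatorname{dist}(x,y)=\psi(X)$. *)

(* Defs.v *)
From HB Require Import structures.
From mathcomp Require Import all_boot all_order all_algebra.
From mathcomp Require Import finmap.
From mathcomp Require Import all_classical all_reals all_analysis.
From mathcomp Require Import lra.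

Set Implicit Arguments.
Unset Strict Implicit.
Unset Printing Implicit Defensive.

Import Order.TTheory GRing.Theory Num.Theory.

Local Open Scope classical_set_scope.
Local Open Scope fset_scope.
Local Open Scope ring_scope.

Section SphericalContacts.
Variable R : realType.
Implicit Types (x y : 'rV[R]_3) (X : {fset 'rV[R]_3}).

(* The library's norm on 'rV[R]_3 is the sup norm, hence an explicit dot
   product. *)
Definition dot x y : R := \sum_(i < 3) x ord0 i * y ord0 i.

Definition sphere : set 'rV[R]_3 := [set x | dot x x = 1].

Definition adist x y : R := acos (dot x y).

(* As [adist] is at most [pi] on the sphere, the default value [pi] plays no
   role when X has at least two points: see [psi_le] and [psi_attained]. *)
Definition psi X : R :=
  \big[Num.min/pi]_(x <- X) \big[Num.min/pi]_(y <- X | y != x) adist x y.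

Definition contact_pairs X : {fset {fset 'rV[R]_3}} :=
  [fset A in fpowerset X |
    `[< exists x y, [/\ x != y, A = [fset x; y] & adist x y = psi X] >]].

Definition num_contacts X : nat := #|` contact_pairs X|.

Definition configuration (N : nat) X : Prop :=
  ([set` X] `<=` sphere)%classic /\ #|` X| = N.

Definition contact_value (N : nat) : pred nat :=
  fun k => `[< exists X, configuration N X /\ num_contacts X = k >].

Lemma adist_le_pi x y : sphere x -> sphere y -> adist x y <= pi.
Proof.
rewrite /sphere /= /adist => hx hy; apply: acos_lepi.
move: hx hy; rewrite /dot !big_ord_recl !big_ord0 /=.
set a := x _ _; set b := x _ _; set c := x _ _.
set a' := y _ _; set b' := y _ _; set c' := y _ _ => hx hy.
have := (sqr_ge0 (a + a'), sqr_ge0 (b + b'), sqr_ge0 (c + c'),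
         sqr_ge0 (a - a'), sqr_ge0 (b - b'), sqr_ge0 (c - c')).
case=> -[] [] [] [] h1 h2 h3 h4 h5 h6.
by apply/andP; split; nra.
Qed.

Lemma psi_le X x y : x \in X -> y \in X -> x != y -> psi X <= adist x y.
Proof.
move=> xX yX xy; rewrite /psi; apply: (@bigmin_inf_seq _ _ _ _ _ x) => //.
by apply: (@bigmin_inf_seq _ _ _ _ _ y) => //; rewrite eq_sym.
Qed.

Lemma bigmin_attained (I : eqType) (s : seq I) (P : pred I) (F : I -> R)
    (b := \big[Num.min/pi]_(i <- s | P i) F i) :
  b = pi \/ exists i, [/\ i \in s, P i & F i = b].
Proof.
rewrite {}/b; elim: s => [|i s IH]; first by left; rewrite big_nil.
rewrite big_cons; case: ifP => Pi; last first.
  by case: IH => [->|[j [js Pj <-]]]; [left|right; exists j; rewrite inE js orbT].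
rewrite minEle; case: ifP => _; first by right; exists i; rewrite inE eqxx.
by case: IH => [->|[j [js Pj <-]]]; [left|right; exists j; rewrite inE js orbT].
Qed.

Lemma psi_attained X : ([set` X] `<=` sphere)%classic -> (1 < #|` X|)%N ->
  exists x y, [/\ x \in X, y \in X, x != y & adist x y = psi X].
Proof.
move=> XS X1.
have [psiE|[x [xX _ xE]]] := bigmin_attained X xpredT
    (fun x => \big[Num.min/pi]_(y <- X | y != x) adist x y); last first.
  have [yE|[y [yX yx yE]]] := bigmin_attained X (fun y => y != x) (adist x).
    have psiE : psi X = pi by rewrite /psi -xE.
    have [y yX] : exists2 y, y \in X & y != x.
      have /fset0Pn[y] : X `\ x != fset0.
        by rewrite -cardfs_gt0; move: X1; rewrite (cardfsD1 x) xX.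
      by rewrite !inE => /andP[]; exists y.
    rewrite eq_sym => xy; exists x, y; split=> //; apply/le_anti.
    by rewrite psi_le// andbT psiE adist_le_pi//; exact: XS.
  by exists x, y; split; rewrite // 1?eq_sym // yE.
have [x xX] : exists x, x \in X.
  by apply/fset0Pn; rewrite -cardfs_gt0; exact: ltn_trans X1.
have [y yX] : exists2 y, y \in X & y != x.
  have /fset0Pn[y] : X `\ x != fset0.
    by rewrite -cardfs_gt0; move: X1; rewrite (cardfsD1 x) xX.
  by rewrite !inE => /andP[]; exists y.
rewrite eq_sym => xy; exists x, y; split=> //; apply/le_anti.
by rewrite psi_le// andbT [psi X]psiE adist_le_pi//; exact: XS.
Qed.

Definition circle_point (n : nat) : 'rV[R]_3 :=
  let t := n.+1%:R^-1 in
  \row_i (if i == 0 then t else if i == 1 then Num.sqrt (1 - t ^+ 2) else 0).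

Lemma circle_point_inj : injective circle_point.
Proof.
move=> m n /rowP/(_ 0); rewrite !mxE /= => /invr_inj /eqP.
by rewrite eqr_nat => /eqP[].
Qed.

Lemma circle_point_sphere n : sphere (circle_point n).
Proof.
rewrite /sphere /= /dot !big_ord_recl big_ord0 !mxE /= mulr0 !addr0 -!expr2.
rewrite sqr_sqrtr ?subrKC// subr_ge0 expr_le1 ?invr_ge0//.
by rewrite invf_le1 ?ler1n ?ltr0n.
Qed.

Lemma configuration_exists N : exists X, configuration N X.
Proof.
exists [fset circle_point (val n) | n : 'I_N]; split.
  by move=> x /= /imfsetP[n _ ->]; exact: circle_point_sphere.
rewrite card_imfset; last exact: inj_comp circle_point_inj val_inj.
by rewrite /= -cardE card_ord.
Qed.

Lemma contact_value_exists N : exists k, contact_value N k.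
Proof.
by have [X XN] := configuration_exists N; exists (num_contacts X); apply/asboolP; exists X.
Qed.

Lemma contact_value_bounded N k : contact_value N k -> (k <= 2 ^ N)%N.
Proof.
move=> /asboolP[X [[_ <-] <-]]; rewrite -card_fpowerset.
by apply/fsubset_leq_card/fsubsetP => A; rewrite !inE => /andP[].
Qed.

Definition max_contacts (N : nat) : nat :=
  ex_maxn (contact_value_exists N) (@contact_value_bounded N).

End SphericalContacts.

(* Main.v *)
Require Import Defs.
From mathcomp Require Import all_boot all_order all_algebra finmap.
From mathcomp Require Import all_classical all_reals all_analysis.
From mathcomp Require Import lra ring zify.

Set Implicit Arguments.
Unset Strict Implicit.
Unset Printing Implicit Defensive.

Import Order.TTheory GRing.Theory Num.Theory.

Local Open Scope ring_scope.

(** Let [c] be the largest scalar product of two points of [X], so that the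
    contacts are the pairs with scalar product [c]. For a contact [x y] the
    functional [x + y] has the value [1 + c] at [x] and [y], and at most
    [2 * c < 1 + c] at the other points: contacts are edges of the convex hull
    of [X], and everything is read off the supporting planes of [X].

    Euler's formula is replaced by two double countings. A supporting plane
    through a contact can be turned about it both ways until it meets a third
    point, so a contact lies in two facets ([edge_two_facets]); a facet with [k]
    points is inscribed in a circle, and hence contains at most [k] contacts
    ([facet_contacts]). Choose a linear height that separates the points. In a
    facet with [k] points all but the lowest and the highest are in the middle;
    a given point is in the middle of at most two facets ([middle_facets]), and
    the two extreme points of [X] are in the middle of none. So the sum of
    [k - 2] over the facets is at most [2 * (N - 2)], and [k <= 3 * (k - 2)]
    gives at most [3 * N - 6] contacts ([contacts_bound]). The two facets at a
    contact coincide only if [X] lies in a plane, and then there are at most [N]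
    contacts, because each point is in at most two of them.

    If a configuration that lies in no plane attains the bound, then every facet
    is a triangle of contacts ([bound_attained_facets]), and no point is
    isolated, since its deletion would violate the bound for [N - 1] points. The
    rotation about a point [v] by the angle of that triangle then permutes the
    neighbours of [v] ([next_inj]). Along an orbit the scalar
    products with the first neighbour satisfy a linear recurrence that involves
    only [c] ([iter_next_dot]), so all the orbits, at all the points, have the
    same size [m >= 3]. As there are at most five neighbours ([degree_le5]),
    they form a single orbit. Hence all the degrees are equal to [m], and
    [N * m = 6 * N - 12] with [3 <= m <= 5] leaves [N = 4], [6] or [12]
    ([bound_attained_card]). The tetrahedron, the octahedron and the icosahedron
    attain these values, and an orthonormal frame settles [N = 3]. *)

(** * Vectors of three-space *)

Section Vectors.
Variable R : realType.
Implicit Types (u v w d e : 'rV[R]_3) (k : R).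

Definition vec3 (a b c : R) : 'rV[R]_3 :=
  \row_i (if i == 0 then a else if i == 1 then b else c).

Lemma vec3E u : u = vec3 (u 0 0) (u 0 1) (u 0 2).
Proof.
apply/rowP => i; rewrite mxE; case: i => -[|[|[|//]]] i /=;
  by congr (u _ _); exact: val_inj.
Qed.

Lemma dotE u v : dot u v = u 0 0 * v 0 0 + u 0 1 * v 0 1 + u 0 2 * v 0 2.
Proof.
rewrite /dot !big_ord_recl big_ord0 /= addr0 addrA.
have -> : lift ord0 ord0 = 1 :> 'I_3 by exact: val_inj.
by have -> : lift ord0 (lift ord0 ord0) = 2 :> 'I_3 by exact: val_inj.
Qed.

Definition cross u v : 'rV[R]_3 :=
  vec3 (u 0 1 * v 0 2 - u 0 2 * v 0 1)
       (u 0 2 * v 0 0 - u 0 0 * v 0 2)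
       (u 0 0 * v 0 1 - u 0 1 * v 0 0).

Definition coordE := (dotE, mxE, eqxx).

Lemma dotC u v : dot u v = dot v u.
Proof. by rewrite !dotE; ring. Qed.

Lemma dotDl u v w : dot (u + v) w = dot u w + dot v w.
Proof. by rewrite !coordE; ring. Qed.

Lemma dotDr u v w : dot u (v + w) = dot u v + dot u w.
Proof. by rewrite !coordE; ring. Qed.

Lemma dotNl u v : dot (- u) v = - dot u v.
Proof. by rewrite !coordE; ring. Qed.

Lemma dotNr u v : dot u (- v) = - dot u v.
Proof. by rewrite !coordE; ring. Qed.

Lemma dotZl k u v : dot (k *: u) v = k * dot u v.
Proof. by rewrite !coordE; ring. Qed.

Lemma dotZr k u v : dot u (k *: v) = k * dot u v.
Proof. by rewrite !coordE; ring. Qed.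

Definition dot_linear := (dotDl, dotDr, dotNl, dotNr, dotZl, dotZr).

Lemma dot0l u : dot 0 u = 0.
Proof. by rewrite !coordE; ring. Qed.

Lemma dot_ge0 u : 0 <= dot u u.
Proof. by rewrite dotE -!expr2 !addr_ge0 ?sqr_ge0. Qed.

Lemma dot_eq0 u : (dot u u == 0) = (u == 0).
Proof.
apply/eqP/eqP => [|->]; last by rewrite dot0l.
rewrite dotE -!expr2 => /eqP; rewrite !paddr_eq0 ?addr_ge0 ?sqr_ge0// !sqrf_eq0.
move=> /andP[/andP[/eqP h0 /eqP h1] /eqP h2].
by rewrite [u]vec3E h0 h1 h2; apply/rowP => i; rewrite !mxE; case: ifP => _ //; case: ifP.
Qed.

Lemma dot_gt0 u : (0 < dot u u) = (u != 0).
Proof. by rewrite lt_def dot_ge0 andbT dot_eq0. Qed.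

Lemma crossE0 u v : cross u v 0 0 = u 0 1 * v 0 2 - u 0 2 * v 0 1.
Proof. by rewrite mxE. Qed.
Lemma crossE1 u v : cross u v 0 1 = u 0 2 * v 0 0 - u 0 0 * v 0 2.
Proof. by rewrite mxE. Qed.
Lemma crossE2 u v : cross u v 0 2 = u 0 0 * v 0 1 - u 0 1 * v 0 0.
Proof. by rewrite mxE. Qed.

Definition crossE := (crossE0, crossE1, crossE2).

Lemma dot_crossl u v : dot u (cross u v) = 0.
Proof. by rewrite dotE !crossE; ring. Qed.

Lemma dot_crossr u v : dot v (cross u v) = 0.
Proof. by rewrite dotE !crossE; ring. Qed.

Lemma dot_cross_cross u v w d :
  dot (cross u v) (cross w d) = dot u w * dot v d - dot u d * dot v w.
Proof. by rewrite !dotE !crossE; ring. Qed.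

Lemma dot_cross3 u v w d :
  dot u (cross v (cross w d)) = dot u w * dot v d - dot u d * dot v w.
Proof. by rewrite !dotE !crossE; ring. Qed.

Lemma cross_rot u v w : dot u (cross v w) = dot v (cross w u).
Proof. by rewrite !dotE !crossE; ring. Qed.

Lemma dot_crossC u v w : dot u (cross w v) = - dot u (cross v w).
Proof. by rewrite !dotE !crossE; ring. Qed.

(** Cramer's rule: four vectors of three-space are linearly dependent, with
    the triple products as coefficients. *)
Lemma cramer3 u v w d e :
  dot u (cross v w) * dot d e =
  dot d (cross v w) * dot u e + dot d (cross w u) * dot v e +
  dot d (cross u v) * dot w e.
Proof. by rewrite !dotE !crossE; ring. Qed.

(** A vector orthogonal to [d] and [e] is a multiple of [cross d e]. *)
Lemma ortho_parallel u d e w : dot u d = 0 -> dot u e = 0 ->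
  dot (cross d e) (cross d e) * dot u w =
  dot u (cross d e) * dot (cross d e) w.
Proof.
move=> ud ue.
have := cramer3 d e (cross d e) u w.
have -> : dot d (cross e (cross d e)) = dot (cross d e) (cross d e).
  by rewrite cross_rot cross_rot.
have -> : dot u (cross (cross d e) d) = 0.
  by rewrite dot_crossC dot_cross3 ud ue; ring.
have -> : dot u (cross e (cross d e)) = 0 by rewrite dot_cross3 ud ue; ring.
by move=> ->; ring.
Qed.

Lemma gram u v w : dot u (cross v w) ^+ 2 =
  dot u u * dot v v * dot w w + 2 * dot u v * dot v w * dot w u
  - dot u u * dot v w ^+ 2 - dot v v * dot w u ^+ 2 - dot w w * dot u v ^+ 2.
Proof. by rewrite !dotE !crossE; ring. Qed.

End Vectors.

(** * Planes and the unit sphere *)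

Section UnitVectors.
Variable R : realType.
Implicit Types (u v w p q r a : 'rV[R]_3).

Lemma dot_unit_lt1 p q : dot p p = 1 -> dot q q = 1 -> p != q -> dot p q < 1.
Proof.
move=> hp hq; rewrite -subr_eq0 -dot_gt0 !dot_linear hp hq (dotC q p).
by move=> ?; lra.
Qed.

(** A line meets the sphere in at most two points. *)
Lemma unit_not_collinear p q r : dot p p = 1 -> dot q q = 1 -> dot r r = 1 ->
  p != q -> p != r -> q != r -> cross (q - p) (r - p) != 0.
Proof.
move=> hp hq hr pq pr qr.
have := dot_unit_lt1 hp hq pq; have := dot_unit_lt1 hp hr pr.
have := dot_unit_lt1 hq hr qr; move=> hqr hpr hpq.
rewrite -dot_eq0 dot_cross_cross; apply/negP => /eqP cs.
set d := dot (q - p) (r - p) in cs.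
set a := dot (q - p) (q - p) in cs; set b := dot (r - p) (r - p) in cs.
have rq : dot (r - p) (q - p) = d by exact: dotC.
rewrite rq in cs.
have dE : d = dot q r - dot p q - dot p r + 1.
  by rewrite /d !dot_linear hp (dotC q p); ring.
have aE : a = 2 - 2 * dot p q by rewrite /a !dot_linear hp hq (dotC q p); ring.
have bE : b = 2 - 2 * dot p r by rewrite /b !dot_linear hp hr (dotC r p); ring.
(* Equality in the Cauchy-Schwarz inequality makes the two chords parallel. *)
have /eqP : dot (a *: (r - p) - d *: (q - p)) (a *: (r - p) - d *: (q - p)) = 0.
  rewrite !dotDl !dotDr !dotNl !dotNr !dotZl !dotZr -/a -/b -/d.
  rewrite rq; transitivity (a * (a * b - d * d)); first by ring.
  by rewrite cs mulr0.
rewrite dot_eq0 => /eqP/(congr1 (dot p)); rewrite [dot p 0]dotC dot0l !dot_linear hp.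
move=> h.
have /eqP : a * (b - d) = 0 by rewrite aE in h *; rewrite bE dE in h *; nra.
rewrite mulf_eq0 subr_eq0 => /orP[/eqP|/eqP bd]; first lra.
have /eqP : b * (a - b) = 0.
  by rewrite -cs -bd; ring.
rewrite mulf_eq0 subr_eq0 => /orP[/eqP|/eqP ab]; first lra.
lra.
Qed.

(** Two planes that share three points of the sphere coincide. *)
Lemma plane_eq u m u' m' p q r w : u != 0 ->
  dot p p = 1 -> dot q q = 1 -> dot r r = 1 ->
  p != q -> p != r -> q != r ->
  dot u p = m -> dot u q = m -> dot u r = m ->
  dot u' p = m' -> dot u' q = m' -> dot u' r = m' ->
  dot u w = m -> dot u' w = m'.
Proof.
move=> u0 hp hq hr pq pr qr up uq ur u'p u'q u'r uw.
have n0 := unit_not_collinear hp hq hr pq pr qr.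
set n := cross _ _ in n0.
have nn0 : dot n n != 0 by rewrite dot_eq0.
have par t k y : dot t p = k -> dot t q = k -> dot t r = k ->
    dot n n * dot t y = dot t n * dot n y.
  by move=> tp tq tr; apply: ortho_parallel; rewrite dotDr dotNr tp ?tq ?tr subrr.
have un0 : dot u n != 0.
  apply/eqP => un; have /eqP := par _ _ u up uq ur.
  by rewrite un mul0r mulf_eq0 (negPf nn0) dot_eq0 (negPf u0).
have nw : dot n (w - p) = 0.
  have /esym/eqP := par _ _ (w - p) up uq ur.
  rewrite [dot u (w - p)]dotDr dotNr uw up subrr mulr0 mulf_eq0 (negPf un0).
  by move/eqP.
have /eqP := par _ _ (w - p) u'p u'q u'r.
rewrite nw mulr0 mulf_eq0 (negPf nn0) dotDr dotNr u'p subr_eq0.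
by move/eqP.
Qed.

(** At most two points of a circle on the sphere are at a given distance from a
    point [a] of that circle: three such points would span both the plane of the
    circle, which contains [a], and the plane of all the points of the sphere at
    that distance from [a], which does not. *)
Lemma circle_equidistant u m a c p q r : u != 0 -> c < 1 ->
  dot p p = 1 -> dot q q = 1 -> dot r r = 1 -> dot a a = 1 ->
  dot u a = m -> dot u p = m -> dot u q = m -> dot u r = m ->
  dot a p = c -> dot a q = c -> dot a r = c ->
  p != q -> p != r -> q = r.
Proof.
move=> u0 c1 hp hq hr ha ua up uq ur ap aq ar pq pr.
apply/eqP; apply: contraT => qr.
have := plane_eq u0 hp hq hr pq pr qr up uq ur ap aq ar ua.
by rewrite ha => h; rewrite h ltxx in c1.
Qed.

End UnitVectors.

(** * Facets and contacts *)

Section Facets.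
Variables (R : realType) (T : finType) (p : T -> 'rV[R]_3) (c : R).
Implicit Types (i j x y z : T) (f : {set T}) (u h : 'rV[R]_3).

Definition adj i j : bool := (i != j) && (dot (p i) (p j) == c).

Definition degree i : nat := #|[set j | adj i j]|.

Lemma adjE i j : adj i j = (i != j) && (dot (p i) (p j) == c).
Proof. by []. Qed.

Lemma degreeE i : degree i = #|[set j | adj i j]|.
Proof. by []. Qed.

Definition supported f u m : Prop :=
  (forall z, dot u (p z) <= m) /\ (forall z, (z \in f) = (dot u (p z) == m)).

(** A facet is recorded as the set of points in its plane, so that it does not
    depend on the choice of a normal. *)
Definition facet f : bool :=
  `[< (2 < #|f|)%N /\ exists u m, u != 0 /\ supported f u m >].

Definition coplanar : Prop :=
  exists u m, u != 0 /\ forall z, dot u (p z) = m.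

Hypothesis p_inj : injective p.
Hypothesis p_unit : forall i, dot (p i) (p i) = 1.
Hypothesis p_le : forall i j, i != j -> dot (p i) (p j) <= c.

Lemma adjC i j : adj i j = adj j i.
Proof. by rewrite /adj eq_sym dotC. Qed.

Lemma p_neq i j : (p i != p j) = (i != j).
Proof. by rewrite (inj_eq p_inj). Qed.

Lemma adj_lt1 x y : adj x y -> c < 1.
Proof.
by move=> /andP[xy /eqP <-]; apply: dot_unit_lt1; rewrite ?p_neq.
Qed.

(** The squared norm of the sum of three unit vectors is not negative. *)
Lemma contact_ge x y z : x != y -> x != z -> y != z -> 0 <= 1 + 2 * c.
Proof.
move=> /p_le xy /p_le xz /p_le yz.
have := dot_ge0 (p x + p y + p z).
rewrite !dotDl !dotDr !p_unit (dotC (p y) (p x)) (dotC (p z) (p x)).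
by rewrite (dotC (p z) (p y)) => ?; lra.
Qed.

(** A supporting plane that contains the contact edge [x y] can be turned around
    the line through [p x] and [p y] until it meets a third point. The plane
    with normal [p x + p y] meets no other point, because [2 * c < 1 + c]; the
    other normals are [s *: (p x + p y) + n], and [s] has to be the largest of
    the slopes below. *)
Lemma turn_plane n x y z0 : n != 0 -> dot n (p x) = 0 -> dot n (p y) = 0 ->
  adj x y -> z0 != x -> z0 != y ->
  exists s z, let u := s *: (p x + p y) + n in
    [/\ z != x, z != y, u != 0, dot u (p z) = s * (1 + c) &
        forall w, dot u (p w) <= s * (1 + c)].
Proof.
move=> n0 nx ny exy z0x z0y.
have [xy /eqP xyc] := andP exy.
pose u0 := p x + p y.
have gap z : z != x -> z != y -> 0 < 1 + c - dot u0 (p z).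
  move=> zx zy; have := adj_lt1 exy; rewrite dotDl (dotC (p x)) (dotC (p y)).
  by have := p_le zx; have := p_le zy => ? ? ?; lra.
pose slope z := dot n (p z) / (1 + c - dot u0 (p z)).
have z0P : (z0 != x) && (z0 != y) by rewrite z0x.
have [z /andP[zx zy] zmax] := @arg_maxP _ _ T z0 (fun z => (z != x) && (z != y))
   slope z0P.
exists (slope z), z; split=> //.
- rewrite -/u0; apply/eqP => /(congr1 (dot n)).
  rewrite [dot n 0]dotC dot0l !dot_linear nx ny addr0 mulr0 add0r => /eqP.
  by rewrite dot_eq0 (negPf n0).
- rewrite -/u0 dotDl dotZl; have := gap z zx zy => g.
  have : slope z * (1 + c - dot u0 (p z)) = dot n (p z).
    by rewrite /slope mulfVK// gt_eqF.
  by move=> <-; ring.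
- move=> w; rewrite -/u0 dotDl dotZl.
  have [->|wx] := eqVneq w x.
    by rewrite nx dotDl p_unit (dotC (p y)) xyc addr0.
  have [->|wy] := eqVneq w y.
    by rewrite ny dotDl p_unit xyc addr0 (addrC c).
  have := gap w wx wy => g.
  have -> : dot n (p w) = slope w * (1 + c - dot u0 (p w)).
    by rewrite /slope mulfVK// gt_eqF.
  have le : 0 <= slope z - slope w by rewrite subr_ge0; apply: zmax; rewrite wx.
  rewrite -subr_ge0; have := mulr_ge0 le (ltW g); congr (_ <= _); ring.
Qed.

(** Turning the plane in the two opposite senses, with normals [n] and [- n],
    gives two facets. *)
Lemma edge_two_facets x y z0 : ~ coplanar -> adj x y -> z0 != x -> z0 != y ->
  (1 < #|[set f | [&& facet f, x \in f & y \in f]]|)%N.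
Proof.
move=> ncop exy z0x z0y.
have [xy /eqP xyc] := andP exy.
have c1 := adj_lt1 exy.
have xz0 : x != z0 by rewrite eq_sym.
have yz0 : y != z0 by rewrite eq_sym.
have c2 := contact_ge xy xz0 yz0.
pose n := cross (p x) (p y).
have n0 : n != 0.
  rewrite -dot_gt0 dot_cross_cross !p_unit xyc (dotC (p y)) xyc.
  by nra.
have nx : dot n (p x) = 0 by rewrite dotC dot_crossl.
have ny : dot n (p y) = 0 by rewrite dotC dot_crossr.
have [s [z [zx zy u0 uz uP]]] := turn_plane n0 nx ny exy z0x z0y.
have [s' [z' [z'x z'y u'0 u'z u'P]]] : exists s z,
    let u := s *: (p x + p y) + (- n) in
    [/\ z != x, z != y, u != 0, dot u (p z) = s * (1 + c) &
        forall w, dot u (p w) <= s * (1 + c)].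
  by apply: (turn_plane _ _ _ exy z0x z0y); rewrite ?oppr_eq0 ?dotNl ?nx ?ny ?oppr0.
set u := _ + n in u0 uz uP; set u' := _ - n in u'0 u'z u'P.
have sumE w : dot (p x + p y) (p w) = dot (p w) (p x) + dot (p w) (p y).
  by rewrite dotDl (dotC (p w)) (dotC (p w) (p y)).
have ux : dot u (p x) = s * (1 + c).
  by rewrite dotDl dotZl nx sumE p_unit xyc addr0.
have uy : dot u (p y) = s * (1 + c).
  by rewrite dotDl dotZl ny sumE p_unit dotC xyc addr0 (addrC c).
have u'x : dot u' (p x) = s' * (1 + c).
  by rewrite dotDl dotNl dotZl nx sumE p_unit xyc subr0.
have u'y : dot u' (p y) = s' * (1 + c).
  by rewrite dotDl dotNl dotZl ny sumE p_unit dotC xyc subr0 (addrC c).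
have three v m t : t != x -> t != y -> dot v (p x) = m -> dot v (p y) = m ->
    dot v (p t) = m -> (2 < #|[set w | dot v (p w) == m]|)%N.
  move=> tx ty vx vy vt; apply/card_gt2P; exists x, y, t.
  by rewrite !inE vx vy vt !eqxx xy eq_sym ty tx.
apply/card_gt1P.
exists [set w | dot u (p w) == s * (1 + c)].
exists [set w | dot u' (p w) == s' * (1 + c)]; split.
- rewrite !inE ux uy !eqxx !andbT; apply/asboolP; split; first exact: (three _ _ z).
  by exists u, (s * (1 + c)); split=> //; split=> // w; rewrite inE.
- rewrite !inE u'x u'y !eqxx !andbT; apply/asboolP; split; first exact: (three _ _ z').
  by exists u', (s' * (1 + c)); split=> //; split=> // w; rewrite inE.
(* If both turns end in the same facet then the two planes are opposite to each
   other, which squeezes all the points into one plane. *)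
apply/eqP => /setP/(_ z); rewrite !inE uz eqxx => /esym/eqP u'z1.
have ss' : s' = - s.
  have : (s + s') * (dot (p x + p y) (p z) - (1 + c)) = 0.
    move: uz u'z1; rewrite !(dotDl _ _ (p z)) dotNl !dotZl !(dotDl _ _ (p z)).
    by move=> ? ?; lra.
  move/eqP; rewrite mulf_eq0 => /orP[/eqP ?|/eqP]; first lra.
  rewrite sumE; have := p_le zx; have := p_le zy => ? ? ?; lra.
apply: ncop; exists u, (s * (1 + c)); split=> // w; apply/eqP; rewrite eq_le uP.
have := u'P w; have -> : u' = - u by rewrite /u' /u ss' scaleNr opprD.
by rewrite dotNl ss' mulNr lerN2.
Qed.

Lemma plane_contacts u m x : u != 0 -> dot u (p x) = m ->
  (#|[set y | adj x y & dot u (p y) == m]| <= 2)%N.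
Proof.
move=> u0 ux; rewrite leqNgt; apply/negP => /card_gt2P[y1 [y2 [y3 []]]].
rewrite !inE => -[/andP[e1 /eqP h1] /andP[e2 /eqP h2] /andP[e3 /eqP h3]].
move=> [y12 y23 y31].
have c1 := adj_lt1 e1.
move: e1 e2 e3 => /andP[_ /eqP d1] /andP[_ /eqP d2] /andP[_ /eqP d3].
have /p_inj/eqP : p y2 = p y3.
  apply: (circle_equidistant u0 c1 (p_unit y1) (p_unit y2) (p_unit y3) (p_unit x)
    ux h1 h2 h3 d1 d2 d3); rewrite p_neq //.
  by rewrite eq_sym.
by rewrite (negPf y23).
Qed.

Lemma facet_contacts f x : facet f -> x \in f ->
  (#|[set y in f | adj x y]| <= 2)%N.
Proof.
move=> /asboolP[_ [u [m [u0 [_ fE]]]]]; rewrite fE => /eqP ux.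
apply: leq_trans (plane_contacts u0 ux); apply: subset_leq_card.
by apply/fintype.subsetP => y; rewrite !inE fE andbC.
Qed.

Lemma facet_eq f g : facet f -> facet g -> (2 < #|f :&: g|)%N -> f = g.
Proof.
move=> /asboolP[_ [u [m [u0 [_ fE]]]]] /asboolP[_ [u' [m' [u'0 [_ gE]]]]].
move=> /card_gt2P[x [y [z []]]]; rewrite !inE !fE !gE.
move=> -[/andP[/eqP ux /eqP u'x] /andP[/eqP uy /eqP u'y] /andP[/eqP uz /eqP u'z]].
move=> [xy yz zx]; have xz : x != z by rewrite eq_sym.
move: xy yz xz; rewrite -!p_neq => xy yz xz.
by apply/setP => w; rewrite fE gE; apply/eqP/eqP => h;
  [apply: (plane_eq u0 _ _ _ xy xz yz ux uy uz)
  |apply: (plane_eq u'0 _ _ _ xy xz yz u'x u'y u'z)].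
Qed.

End Facets.

(** * Facets that a vertex splits in height *)

(** The ray spanned by [q] lies on the boundary of a planar cone when a line
    through it supports the cone; a pointed planar cone has only two boundary
    rays. Here the plane is orthogonal to [h], the functional [v] shows that the
    cone is pointed, and [u1], [u2], [u3] are the supporting lines. *)
Lemma planar_cone_sides (R : realType) (h v u1 u2 u3 q1 q2 q3 : 'rV[R]_3) :
  h != 0 -> dot h q1 = 0 -> dot h q2 = 0 -> dot h q3 = 0 ->
  dot v q1 < 0 -> dot v q2 < 0 ->
  dot u1 q1 = 0 -> dot u1 q2 < 0 -> dot u1 q3 < 0 ->
  dot u2 q2 = 0 -> dot u2 q1 < 0 -> dot u2 q3 < 0 ->
  dot u3 q3 = 0 -> dot u3 q1 < 0 -> dot u3 q2 < 0 -> False.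
Proof.
move=> h0 hq1 hq2 hq3 vq1 vq2 u11 u12 u13 u22 u21 u23 u33 u31 u32.
have hh : dot h h != 0 by rewrite dot_eq0.
have rel e : dot h (cross q2 q3) * dot q1 e + dot h (cross q3 q1) * dot q2 e +
             dot h (cross q1 q2) * dot q3 e = 0.
  rewrite -cramer3; apply/eqP; rewrite mulf_eq0; apply/orP; left.
  have /eqP := cramer3 q1 q2 q3 h h.
  by rewrite !(dotC _ h) hq1 hq2 hq3 !mulr0 !addr0 mulf_eq0 (negPf hh) orbF.
set A := dot h _ in rel; set B := dot h _ in rel; set C := dot h _ in rel.
have := rel u1; have := rel u2; have := rel u3.
rewrite !(dotC _ u1) !(dotC _ u2) !(dotC _ u3) u11 u22 u33.
rewrite !mulr0 add0r !addr0 => r3 r2 r1.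
have opp (x y s t : R) : s < 0 -> t < 0 -> x * s + y * t = 0 -> 0 < x -> y < 0.
  by move=> s0 t0 e x0; rewrite ltNge; apply/negP => y0; nra.
have opp' (x y s t : R) : s < 0 -> t < 0 -> x * s + y * t = 0 -> x < 0 -> 0 < y.
  by move=> s0 t0 e x0; rewrite ltNge; apply/negP => y0; nra.
have C0 : C = 0.
  apply: contraTeq isT => /lt_total/orP[C0|C0].
  - have B0 : 0 < B by apply: (opp' C B _ _ u13 u12) => //; rewrite addrC.
    have A0 : A < 0 by apply: (opp B A _ _ u32 u31) => //; rewrite addrC.
    by have := opp' _ _ _ _ u21 u23 r2 A0; lra.
  - have B0 : B < 0 by apply: (opp C B _ _ u13 u12) => //; rewrite addrC.
    have A0 : 0 < A by apply: (opp' B A _ _ u32 u31) => //; rewrite addrC.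
    by have := opp _ _ _ _ u21 u23 r2 A0; lra.
(* [q1] and [q2] are parallel, and they point in the same direction. *)
have par : dot v q1 * dot u1 q2 = dot v q2 * dot u1 q1.
  have := ortho_parallel h hq1 hq2.
  rewrite -/C C0 mul0r => /eqP; rewrite mulf_eq0 (negPf hh) orbF dot_eq0.
  move=> /eqP q12; apply/eqP; rewrite -subr_eq0 -dot_cross_cross q12.
  by rewrite dotC dot0l.
by rewrite u11 in par; nra.
Qed.

Section Heights.
Variables (R : realType) (T : finType) (p : T -> 'rV[R]_3).
Implicit Types (i j x y z : T) (f : {set T}) (u : 'rV[R]_3).

Lemma poly_nonroot (q : {poly R}) : q != 0 -> exists t, q.[t] != 0.
Proof.
move=> q0; pose rs : seq R := [seq n%:R | n <- iota 0 (size q)].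
have : ~~ all (root q) rs.
  apply/negP => /(max_poly_roots q0); rewrite map_inj_uniq ?iota_uniq.
    by rewrite size_map size_iota ltnn => /(_ isT).
  by move=> m n /eqP; rewrite eqr_nat => /eqP.
by move=> /allPn[t _]; exists t.
Qed.

(** The functionals [(1, t, t ^+ 2)] separate two given points for all but
    finitely many [t]. *)
Lemma generic_height : injective p -> exists h, injective (fun i => dot h (p i)).
Proof.
move=> p_inj.
pose P i j : {poly R} :=
  Poly [:: (p i - p j) 0 0; (p i - p j) 0 1; (p i - p j) 0 2].
have P0 i j : j != i -> P i j != 0.
  apply: contraNneq => P0; rewrite eq_sym -(inj_eq p_inj) -subr_eq0.
  have coef k : (P i j)`_k = 0 by rewrite P0 coef0.
  have := (coef 0%N, coef 1%N, coef 2%N); rewrite !coef_Poly /= => -[[c0 c1] c2].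
  rewrite -dot_eq0 dotE c0 c1 c2; apply/eqP; ring.
have [|t] := @poly_nonroot (\prod_i \prod_(j | j != i) P i j).
  by apply/prodf_neq0 => i _; apply/prodf_neq0 => j; exact: P0.
rewrite horner_prod => /prodf_neq0 Pt; exists (vec3 1 t (t ^+ 2)) => i j /eqP.
rewrite -subr_eq0 -dotNr -dotDr => /eqP hij; apply/eqP; apply: contraT => ij.
have := Pt i isT; rewrite horner_prod => /prodf_neq0/(_ j).
rewrite eq_sym => /(_ ij) /negP; case.
rewrite horner_Poly /=; apply/eqP; rewrite -[RHS]hij dotE ![vec3 _ _ _ _ _]mxE.
by rewrite /=; ring.
Qed.

Variable h : 'rV[R]_3.
Let H i := dot h (p i).

Definition middle f v : bool :=
  [&& v \in f, [exists a in f, H a < H v] & [exists b in f, H v < H b]].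

Hypothesis p_inj : injective p.
Hypothesis p_unit : forall i, dot (p i) (p i) = 1.

(** The level set of [h] through [p v] meets the facet [f] in a segment with
    direction [q]. *)
Lemma level_direction f v : facet p f -> middle f v -> exists q,
  [/\ dot h q = 0, dot (p v) q < 0 &
  forall g u m, facet p g -> supported p g u m -> v \in g ->
    if g == f then dot u q = 0 else dot u q < 0].
Proof.
move=> Ff /and3P[vf /exists_inP[a af av] /exists_inP[b bf vb]].
have lt1 t : H t != H v -> dot (p v) (p t) < 1.
  move=> tv; apply: dot_unit_lt1 => //; rewrite (inj_eq p_inj).
  by apply: contraNneq tv => ->.
have va1 : dot (p v) (p a) < 1 by apply: lt1; rewrite lt_eqF.
have vb1 : dot (p v) (p b) < 1 by apply: lt1; rewrite gt_eqF.
exists ((H b - H v) *: (p a - p v) + (H v - H a) *: (p b - p v)); split.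
- by rewrite !dot_linear -!/(H _); ring.
- by rewrite !dot_linear p_unit; nra.
move=> g u m Fg [uP gE] vg.
have uv : dot u (p v) = m by apply/eqP; rewrite -gE.
rewrite !dot_linear uv.
have ua := uP a; have ub := uP b.
case: ifP => [/eqP gf|/negP gf].
  have -> : dot u (p a) = m by apply/eqP; rewrite -gE gf.
  have -> : dot u (p b) = m by apply/eqP; rewrite -gE gf.
  ring.
rewrite lt_neqAle; apply/andP; split; last by nra.
apply/eqP => e; apply: gf; apply/eqP; apply: (@facet_eq _ _ p p_inj p_unit) => //.
have ag : a \in g by rewrite gE; apply/eqP; nra.
have bg : b \in g by rewrite gE; apply/eqP; nra.
apply/card_gt2P; exists v, a, b; split; first by rewrite !inE vg vf ag af bg bf.
have ne s t : H s < H t -> s != t by apply: contraTneq => ->; rewrite ltxx.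
by split; [rewrite eq_sym ne|apply: ne; apply: lt_trans av vb|rewrite eq_sym ne].
Qed.

Lemma middle_facets v : (#|[set f | facet p f & middle f v]| <= 2)%N.
Proof.
rewrite leqNgt; apply/negP => /card_gt2P[f1 [f2 [f3 []]]].
rewrite !inE => -[/andP[F1 M1] /andP[F2 M2] /andP[F3 M3]] [n12 n23 n31].
have [q1 [hq1 vq1 Q1]] := level_direction F1 M1.
have [q2 [hq2 vq2 Q2]] := level_direction F2 M2.
have [q3 [hq3 vq3 Q3]] := level_direction F3 M3.
have v1 : v \in f1 by case/and3P: M1.
have v2 : v \in f2 by case/and3P: M2.
have v3 : v \in f3 by case/and3P: M3.
have /asboolP[_ [u1 [m1 [_ S1]]]] := F1.
have /asboolP[_ [u2 [m2 [_ S2]]]] := F2.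
have /asboolP[_ [u3 [m3 [_ S3]]]] := F3.
have n21 : f2 != f1 by rewrite eq_sym.
have n32 : f3 != f2 by rewrite eq_sym.
have n13 : f1 != f3 by rewrite eq_sym.
have h0 : h != 0.
  case/and3P: M1 => _ /exists_inP[a _ av] _.
  by apply: contraTneq av => h0; rewrite /H h0 !dot0l ltxx.
have := Q1 _ _ _ F1 S1 v1; have := Q2 _ _ _ F1 S1 v1; have := Q3 _ _ _ F1 S1 v1.
have := Q1 _ _ _ F2 S2 v2; have := Q2 _ _ _ F2 S2 v2; have := Q3 _ _ _ F2 S2 v2.
have := Q1 _ _ _ F3 S3 v3; have := Q2 _ _ _ F3 S3 v3; have := Q3 _ _ _ F3 S3 v3.
rewrite !eqxx (negPf n12) (negPf n21) (negPf n23) (negPf n32) (negPf n13) (negPf n31).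
move=> u33 u32 u31 u23 u22 u21 u13 u12 u11.
exact: (@planar_cone_sides R h (p v) u1 u2 u3 q1 q2 q3).
Qed.

End Heights.

(** * Counting contacts *)

Lemma eq_leq_sum (I : finType) (P : pred I) (E1 E2 : I -> nat) :
  (forall i, P i -> E1 i <= E2 i)%N ->
  (\sum_(i | P i) E2 i <= \sum_(i | P i) E1 i)%N ->
  forall i, P i -> E1 i = E2 i.
Proof.
move=> le12 le21 i Pi.
have := leqif_sum (fun i Pi => leqif_eq (le12 i Pi)).
by move/geq_leqif; rewrite le21 => /esym/forall_inP/(_ i Pi)/eqP.
Qed.

Section Counting.
Variables (R : realType) (T : finType) (p : T -> 'rV[R]_3) (c : R).
Implicit Types (i j x y z v : T) (f : {set T}) (u h : 'rV[R]_3).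
Hypothesis p_inj : injective p.
Hypothesis p_unit : forall i, dot (p i) (p i) = 1.
Hypothesis p_le : forall i j, i != j -> dot (p i) (p j) <= c.
Local Notation adj := (adj p c).
Local Notation facet := (facet p).
Local Notation degree := (degree p c).

Lemma facet_contacts_sum f : facet f ->
  (\sum_(x in f) #|[set y in f | adj x y]| <= 2 * #|f|)%N.
Proof.
move=> Ff; rewrite mulnC -sum_nat_const; apply: leq_sum => x xf.
exact: facet_contacts.
Qed.

Lemma third_point x y : (2 < #|T|)%N -> exists z, z != x /\ z != y.
Proof.
move=> T2; suff: [set~ x] :\ y != finset.set0.
  by move=> /set0Pn[z]; rewrite !inE => /andP[? ?]; exists z.
rewrite -card_gt0 -(ltn_add2l (y \in [set~ x])) -cardsD1 cardsC1 addn0.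
by case: (_ \in _); move: T2; case: #|T| => [|[|[|n]]].
Qed.

(** Each contact is counted in both directions, and in at least two facets. *)
Lemma degree_facets : (2 < #|T|)%N -> ~ coplanar p ->
  (2 * \sum_x degree x <= \sum_(f | facet f) \sum_(x in f)
     #|[set y in f | adj x y]|)%N.
Proof.
move=> T2 ncop.
have -> : (\sum_(f | facet f) \sum_(x in f) #|[set y in f | adj x y]| =
  \sum_x \sum_(y | adj x y) #|[set f | [&& facet f, x \in f & y \in f]]|)%N.
  rewrite (exchange_big_dep predT) //=; apply: eq_bigr => x _.
  under eq_bigr => f _ do rewrite -sum1dep_card.
  rewrite (exchange_big_dep (adj x)) /=; last by move=> f y _ /andP[].
  apply: eq_bigr => y xy; rewrite -sum1dep_card; apply: eq_bigl => f.
  by rewrite xy andbT andbA.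
rewrite big_distrr /=; apply: leq_sum => x _.
rewrite mulnC -sum_nat_const (eq_bigl (adj x)); last by move=> y; rewrite inE.
apply: leq_sum => y xy; have [z [zx zy]] := third_point x y T2.
exact: (edge_two_facets p_inj p_unit p_le ncop xy zx zy).
Qed.

Section Height.
Variable h : 'rV[R]_3.
Hypothesis h_inj : injective (fun i => dot h (p i)).
Let H i := dot h (p i).

(** All points of a facet but the lowest and the highest are in its middle. *)
Lemma card_middle f : (0 < #|f|)%N ->
  (#|f| <= #|[set v | middle p h f v]| + 2)%N.
Proof.
move=> /card_gt0P[x0 x0f].
have [a af amin] := @arg_minP _ _ T x0 (fun x => x \in f) H x0f.
have [b bf bmax] := @arg_maxP _ _ T x0 (fun x => x \in f) H x0f.
have sub : f \subset [set v | middle p h f v] :|: [set a; b].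
  apply/fintype.subsetP => v vf; rewrite !inE.
  have [//|va] := eqVneq v a; first by rewrite orbT.
  have [//|vb] := eqVneq v b; first by rewrite !orbT.
  rewrite !orbF /middle vf /=; apply/andP; split; apply/exists_inP.
  - by exists a => //; rewrite lt_neqAle (inj_eq h_inj) eq_sym va amin.
  - by exists b => //; rewrite lt_neqAle (inj_eq h_inj) vb; apply: bmax.
apply: leq_trans (subset_leq_card sub) _; rewrite cardsU.
apply: leq_trans (leq_subr _ _) _; rewrite leq_add2l cards2.
by case: (_ != _).
Qed.

(** The lowest and the highest of all the points are in the middle of no
    facet, and the others are in the middle of at most two. *)
Lemma middle_sum : (1 < #|T|)%N ->
  (\sum_(f | facet f) #|[set v | middle p h f v]| <= 2 * (#|T| - 2))%N.
Proof.
move=> /card_gt1P[x0 [y0 [_ _ xy0]]].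
have [a _ amin] := @arg_minP _ _ T x0 predT H isT.
have [b _ bmax] := @arg_maxP _ _ T x0 predT H isT.
have ab : a != b.
  apply: contraNneq xy0 => ab; apply/eqP/h_inj/le_anti.
  have le x y : H x <= H y.
    by apply: (@le_trans _ _ (H a)); [rewrite ab; apply: bmax|apply: amin].
  by rewrite !le.
under eq_bigr => f _ do rewrite -sum1dep_card.
rewrite (exchange_big_dep (fun v => v \notin [set a; b])) /=.
  have <- : #|~: [set a; b]| = (#|T| - 2)%N.
    by rewrite cardsCs finset.setCK cards2 ab.
  rewrite mulnC -sum_nat_const.
  rewrite [X in (_ <= X)%N](eq_bigl (fun v => v \notin [set a; b])); last first.
    by move=> v; rewrite inE.
  apply: leq_sum => v _; rewrite sum1dep_card.
  exact: middle_facets.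
move=> f v _ /and3P[_ /exists_inP[x _ xv] /exists_inP[y _ vy]].
rewrite !inE negb_or; apply/andP; split.
- by apply: contraTneq xv => ->; rewrite -leNgt amin.
- by apply: contraTneq vy => ->; rewrite -leNgt; apply: bmax.
Qed.

End Height.

(** A facet with [k] points has [k - 2] in its middle, and
    [k <= 3 * (k - 2)] with equality for triangles. *)
Lemma facet_middle h f : injective (fun i => dot h (p i)) -> facet f ->
  (#|f| <= 3 * #|[set v | middle p h f v]| ?= iff
     (#|[set v | middle p h f v]| == 1))%N.
Proof.
move=> h_inj /asboolP[f3 _].
have := card_middle h_inj (ltnW (ltnW f3)).
set k := #|f| in f3 *; set m := #|_| => km; split; first lia.
by apply/eqP/eqP; lia.
Qed.

Lemma facet_contacts_facets :
  (\sum_(f | facet f) \sum_(x in f) #|[set y in f | adj x y]| <=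
   2 * \sum_(f | facet f) #|f|)%N.
Proof. by rewrite big_distrr; apply: leq_sum => f; exact: facet_contacts_sum. Qed.

Lemma facet_middle_sum h : injective (fun i => dot h (p i)) ->
  (\sum_(f | facet f) #|f| <=
   3 * \sum_(f | facet f) #|[set v | middle p h f v]|)%N.
Proof.
move=> h_inj; rewrite big_distrr; apply: leq_sum => f Ff.
exact: (facet_middle h_inj Ff).1.
Qed.

Lemma contacts_bound : (2 < #|T|)%N -> ~ coplanar p ->
  (\sum_x degree x <= 6 * (#|T| - 2))%N.
Proof.
move=> T2 ncop; have [h h_inj] := generic_height p_inj.
have le1 := degree_facets T2 ncop.
have le2 := facet_contacts_facets.
have le3 := facet_middle_sum h_inj.
have le4 := middle_sum h_inj (ltnW T2).
lia.
Qed.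

(** All the inequalities behind [contacts_bound] are sums over the facets of
    local ones, which have to be equalities. *)
Lemma bound_attained_facets : (2 < #|T|)%N -> ~ coplanar p ->
  (6 * (#|T| - 2) <= \sum_x degree x)%N ->
  forall f, facet f ->
    #|f| = 3 /\ forall x, x \in f -> #|[set y in f | adj x y]| = 2.
Proof.
move=> T2 ncop eqD f Ff; have [h h_inj] := generic_height p_inj.
have le1 := degree_facets T2 ncop.
have le2 g (Fg : facet g) := facet_contacts_sum Fg.
have le3 g (Fg : facet g) := (facet_middle h_inj Fg).1.
have le4 := middle_sum h_inj (ltnW T2).
have sle2 := facet_contacts_facets.
have sle3 := facet_middle_sum h_inj.
split.
- have /(_ _ f Ff) kE := eq_leq_sum le3.
  have {}kE : #|f| = (3 * #|[set v | middle p h f v]|)%N.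
    apply: kE; apply: (@leq_trans (3 * \sum_(f | facet f)
      #|[set v | middle p h f v]|)%N); first by rewrite big_distrr.
    by lia.
  have /eqP := kE; rewrite (facet_middle h_inj Ff).2 => /eqP m1.
  by rewrite kE m1.
- have /(_ _ f Ff) sE := eq_leq_sum le2.
  have {}sE : (\sum_(x in f) #|[set y in f | adj x y]| = 2 * #|f|)%N.
    apply: sE; apply: (@leq_trans (2 * \sum_(f | facet f) #|f|)%N);
      first by rewrite big_distrr.
    by lia.
  apply: (@eq_leq_sum _ (mem f) _ (fun=> 2)) => [x|].
    exact: (facet_contacts c p_inj p_unit Ff).
  by rewrite sE sum_nat_const mulnC.
Qed.

(** The two facets at a contact are different triangles with this side. *)
Lemma bound_attained_edges x y : (2 < #|T|)%N -> ~ coplanar p ->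
  (6 * (#|T| - 2) <= \sum_x degree x)%N -> adj x y ->
  exists z z', [/\ z != z', adj x z, adj y z, adj x z' & adj y z'].
Proof.
move=> T2 ncop eqD xy; have [z0 [z0x z0y]] := third_point x y T2.
have apex f : facet f -> x \in f -> y \in f ->
    exists z, [/\ f = [set x; y; z], adj x z & adj y z].
  move=> Ff xf yf; have [f3 fdeg] := bound_attained_facets T2 ncop eqD Ff.
  have xyn : x != y by case/andP: xy.
  have : (0 < #|f :\: [set x; y]|)%N.
    rewrite cardsD; have : (#|f :&: [set x; y]| <= 2)%N.
      apply: leq_trans (subset_leq_card (finset.subsetIr _ _)) _.
      by rewrite cards2 xyn.
    by rewrite f3; lia.
  move=> /card_gt0P[z]; rewrite !inE negb_or => /andP[/andP[zx zy] zf].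
  have fE : f = [set x; y; z].
    apply/esym/eqP; rewrite eqEcard f3 (finset.setUC _ [set z]) cardsU1 cards2.
    apply/andP; split; last by rewrite !inE negb_or zx zy xyn.
    by apply/fintype.subsetP => w; rewrite !inE => /or3P[] /eqP->.
  exists z; split=> //.
  - have : [set w in f | adj x w] == [set y; z].
      rewrite eqEcard fdeg // cards2 eq_sym zy andbT.
      apply/fintype.subsetP => w; rewrite fE !inE => /andP[+ /andP[xw _]].
      by rewrite (eq_sym w x) (negPf xw).
    by move=> /eqP/setP/(_ z); rewrite !inE eqxx orbT => /andP[].
  - have : [set w in f | adj y w] == [set x; z].
      rewrite eqEcard fdeg // cards2 eq_sym zx andbT.
      apply/fintype.subsetP => w; rewrite fE !inE => /andP[+ /andP[yw _]].
      by rewrite (eq_sym w y) (negPf yw) orbF.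
    by move=> /eqP/setP/(_ z); rewrite !inE eqxx orbT => /andP[].
have /card_gt1P[f [g [Ff Fg fg]]] := edge_two_facets p_inj p_unit p_le ncop xy z0x z0y.
rewrite !inE in Ff Fg; have [Ff1 Ff2 Ff3] := and3P Ff.
have [Fg1 Fg2 Fg3] := and3P Fg.
have [z [fE xz yz]] := apex f Ff1 Ff2 Ff3.
have [z' [gE xz' yz']] := apex g Fg1 Fg2 Fg3.
exists z, z'; split=> //; apply: contraNneq fg => zz'.
by rewrite fE gE zz'.
Qed.

End Counting.

(** * Turning around a vertex *)

(** The part of the unit circle with [x < 1 / 2] is covered by four sectors of
    angle [pi / 3], cut out by the signs of [y] and of [x + 1 / 2]; two unit
    vectors in one sector have scalar product at least [1 / 2]. *)
Lemma same_sector (R : realType) (x y x' y' : R) :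
  x ^+ 2 + y ^+ 2 = 1 -> x' ^+ 2 + y' ^+ 2 = 1 ->
  x < 1 / 2 -> x' < 1 / 2 ->
  (0 <= y) = (0 <= y') -> (- (1 / 2) <= x) = (- (1 / 2) <= x') ->
  1 / 2 <= x * x' + y * y'.
Proof.
(* Reflect in the horizontal axis. *)
wlog y0 : y y' / 0 <= y => [wl h h' x1 x1' yy xx|h h' x1 x1' /esym yy xx].
  have [y0|y0] := leP 0 y; first exact: wl.
  have y'0 : y' < 0 by rewrite ltNge -yy -ltNge.
  rewrite -(mulrNN y); apply: wl; rewrite ?sqrrN //; lra.
rewrite y0 in yy.
have [xl|xl] := leP (- (1 / 2)) x; last first.
  have xl' : x' < - (1 / 2) by rewrite ltNge -xx -ltNge.
  have A1 : (x * y') ^+ 2 <= 3 / 4 by rewrite exprMn; nra.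
  have A2 : (x' * y) ^+ 2 <= 3 / 4 by rewrite exprMn; nra.
  have A3 : x * y' <= 0 by nra.
  have A3' : x' * y <= 0 by nra.
  have A4 : (x * y' - x' * y) ^+ 2 <= 3 / 4.
    set P := x * y' in A1 A3 *; set Q := x' * y in A2 A3' *.
    have [PQ|PQ] := leP P Q.
      have : 0 <= (- Q) * (Q - P - P) by apply: mulr_ge0; lra.
      by move: A1; rewrite !expr2; lra.
    have : 0 <= (- P) * (P - Q - Q) by apply: mulr_ge0; lra.
    by move: A2; rewrite !expr2; lra.
  have A5 : (x * x' + y * y') ^+ 2 + (x * y' - x' * y) ^+ 2 = 1.
    by transitivity ((x ^+ 2 + y ^+ 2) * (x' ^+ 2 + y' ^+ 2)); [ring|rewrite h h' mulr1].
  have A6 : 0 <= x * x' + y * y' by nra.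
  by rewrite leNgt; apply/negP => ?; nra.
have xl' : - (1 / 2) <= x' by rewrite -xx.
have B1 : 3 / 4 <= y ^+ 2 by nra.
have B2 : 3 / 4 <= y' ^+ 2 by nra.
have B : (3 / 4) ^+ 2 <= (y * y') ^+ 2.
  by rewrite [(y * y') ^+ 2]exprMn [(3 / 4) ^+ 2]expr2; apply: ler_pM => //; lra.
have B' : 3 / 4 <= y * y'.
  by rewrite -(@ler_pXn2r _ 2) // ?nnegrE; [lra|exact: mulr_ge0].
nra.
Qed.

Section Rotation.
Variables (R : realType) (T : finType) (p : T -> 'rV[R]_3) (c : R).
Implicit Types (i j x y z v a b e : T).
Hypothesis p_inj : injective p.
Hypothesis p_unit : forall i, dot (p i) (p i) = 1.
Hypothesis p_le : forall i j, i != j -> dot (p i) (p j) <= c.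
Local Notation adj := (adj p c).
Local Notation degree := (degree p c).

(** Let [t x] be the projection [p x - c *: p v] of a neighbour of [v] to the
    tangent plane at [v]. The sides of the equation evaluate the product of
    [t b] and [t b'], up to a common factor, without and with coordinates in the
    orthogonal frame [t a], [cross (p v) (p a)]. *)
Lemma tangent_dot v a b b' : adj v a -> adj v b -> adj v b' ->
  (1 - c ^+ 2) * (dot (p b) (p b') - c ^+ 2) =
  (dot (p b) (p a) - c ^+ 2) * (dot (p b') (p a) - c ^+ 2) +
  dot (p b) (cross (p v) (p a)) * dot (p b') (cross (p v) (p a)).
Proof.
move=> /andP[_ /eqP va] /andP[_ /eqP vb] /andP[_ /eqP vb'].
set n := cross (p v) (p a).
have nn : dot n n = 1 - c ^+ 2.
  by rewrite /n dot_cross_cross !p_unit (dotC (p a)) va; ring.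
have := cramer3 (p v) (p a) n (p b) (p b').
have -> : dot (p v) (cross (p a) n) = 1 - c ^+ 2 by rewrite cross_rot cross_rot -/n.
have -> : dot (p b) (cross (p a) n) = c - dot (p b) (p a) * c.
  by rewrite /n dot_cross3 p_unit (dotC (p a) (p v)) va (dotC (p b)) vb; ring.
have -> : dot (p b) (cross n (p v)) = dot (p b) (p a) - c ^+ 2.
  by rewrite /n dot_crossC dot_cross3 p_unit va (dotC (p b) (p v)) vb; ring.
rewrite -/n (dotC n) vb' (dotC (p a) (p b')) mulrBr => ->; ring.
Qed.

(** Distinct neighbours of [v] are seen from [v] under an angle greater than
    [pi / 3]. *)
Lemma degree_le5 v : (degree v <= 5)%N.
Proof.
rewrite leqNgt; apply/negP => d6.
have /card_gt0P[a] : (0 < degree v)%N by lia.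
rewrite inE => va; have c1 := adj_lt1 p_inj p_unit va.
have cm : -1 < c.
  have : (1 < #|[set b | adj v b]|)%N by apply: leq_trans d6.
  rewrite (cardsD1 a) inE va add1n ltnS => /card_gt0P[b].
  rewrite !inE => /andP[ba vb].
  have := contact_ge p_unit p_le (andP va).1 (andP vb).1.
  by rewrite eq_sym ba => /(_ isT) ?; lra.
pose S := 1 - c ^+ 2.
have S0 : 0 < S by rewrite /S; nra.
pose X b := (dot (p b) (p a) - c ^+ 2) / S.
pose Y b := dot (p b) (cross (p v) (p a)) / S.
have XY b b' : adj v b -> adj v b' ->
    X b * X b' + Y b * Y b' = (dot (p b) (p b') - c ^+ 2) / S.
  move=> vb vb'; have := tangent_dot va vb vb'; rewrite -/S => E.
  have S1 : S != 0 by rewrite gt_eqF.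
  have -> : dot (p b) (p b') - c ^+ 2 =
      S^-1 * (S * (dot (p b) (p b') - c ^+ 2)) by rewrite mulKf.
  by rewrite E /X /Y; field.
have half b b' : b != b' -> (dot (p b) (p b') - c ^+ 2) / S < 1 / 2.
  by move=> /p_le le; rewrite ltr_pdivrMr // /S; nra.
pose g b := (0 <= Y b, - (1 / 2) <= X b).
have g_inj : {in [set b | adj v b] :\ a &, injective g}.
  move=> b b'; rewrite !inE => /andP[ba vb] /andP[ba' vb'] [gY gX].
  apply/eqP; apply: contraT => bb'.
  have unit t : adj v t -> X t ^+ 2 + Y t ^+ 2 = 1.
    by move=> vt; rewrite !expr2 XY // p_unit divff // gt_eqF.
  have := same_sector (unit _ vb) (unit _ vb') (half _ _ ba) (half _ _ ba') gY gX.
  by rewrite XY // leNgt half.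
have : (#|g @: ([set b | adj v b] :\ a)| <= 4)%N.
  by apply: leq_trans (max_card _) _; rewrite card_prod card_bool.
rewrite (card_in_imset g_inj) => le4.
by move: d6; rewrite degreeE (cardsD1 a) inE va add1n ltnS ltnNge le4.
Qed.

Section Turning.
Hypothesis apexes : forall x y, adj x y ->
  exists z z', [/\ z != z', adj x z, adj y z, adj x z' & adj y z'].

Let tri x y z := dot (p x) (cross (p y) (p z)).

Lemma adj_dot x y : adj x y -> dot (p x) (p y) = c.
Proof. by case/andP => _ /eqP. Qed.

Lemma apexes_bounds x y : adj x y -> -1 < c < 1.
Proof.
move=> xy; rewrite (adj_lt1 p_inj p_unit xy) andbT.
have [z [_ [_ xz yz _ _]]] := apexes xy.
have := contact_ge p_unit p_le (andP xy).1 (andP xz).1 (andP yz).1.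
by move=> ?; lra.
Qed.

Lemma apexes_neq0 x y : adj x y -> 1 - c * c != 0.
Proof.
move=> /apexes_bounds/andP[cm c1].
by rewrite -[X in X - _]mulr1 -expr2 -expr2 subr_sqr mulf_neq0 //; lra.
Qed.

(** The Gram determinant of a contact triangle. Only the sign of [tri] is left
    free, which distinguishes the two triangles on a common side. *)
Lemma tri_sq x y z : adj x y -> adj x z -> adj y z ->
  tri x y z ^+ 2 = 1 + 2 * c ^+ 3 - 3 * c ^+ 2.
Proof.
move=> xy xz yz; rewrite gram !p_unit (dotC (p z)) !adj_dot //; ring.
Qed.

Lemma tri_inj v a b b' : adj v a -> adj v b -> adj a b -> adj v b' -> adj a b' ->
  tri v a b = tri v a b' -> b = b'.
Proof.
move=> va vb ab vb' ab'.
rewrite /tri !(cross_rot (p v)) !(cross_rot (p a)) => e.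
pose w := p b - p b'.
have wv : dot w (p v) = 0.
  by rewrite dotDl dotNl (dotC (p b)) (dotC (p b')) !adj_dot ?subrr.
have wa : dot w (p a) = 0.
  by rewrite dotDl dotNl (dotC (p b)) (dotC (p b')) !adj_dot ?subrr.
have := ortho_parallel w wv wa.
rewrite [dot w (cross _ _)]dotDl dotNl e subrr mul0r => /eqP.
rewrite mulf_eq0 => /orP[|].
  rewrite dot_cross_cross !p_unit (dotC (p a)) !adj_dot // mulr1.
  by rewrite (negPf (apexes_neq0 va)).
by rewrite dot_eq0 subr_eq0 => /eqP/p_inj.
Qed.

Lemma apex_pos v a : adj v a -> exists b, [/\ adj v b, adj a b & 0 < tri v a b].
Proof.
move=> va; have [z [z' [zz' vz az vz' az']]] := apexes va.
have ne : tri v a z != tri v a z'.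
  by apply: contraNneq zz' => /(tri_inj va vz az vz' az') ->.
have e : tri v a z ^+ 2 = tri v a z' ^+ 2 by rewrite !tri_sq.
move/eqP: e; rewrite eqf_sqr (negPf ne) /= => /eqP e.
have [lt0|gt0|e0] := ltrgtP (tri v a z) 0.
- by exists z'; split => //; rewrite -oppr_lt0 -e.
- by exists z.
- by move: ne; rewrite -[tri v a z']opprK -e e0 oppr0 eqxx.
Qed.

(** The next neighbour of [v] after [a], at an angle equal to that of the
    contact triangle. *)
Definition next v a : T :=
  if adj v a then odflt a [pick b | [&& adj v b, adj a b & 0 < tri v a b]] else a.

Lemma nextP v a : adj v a ->
  [/\ adj v (next v a), adj a (next v a) & 0 < tri v a (next v a)].
Proof.
move=> va; rewrite /next va; case: pickP => [b /and3P[]//|none].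
by have [b [vb ab t]] := apex_pos va; have := none b; rewrite vb ab t.
Qed.

Lemma tri_swap v a b : tri v b a = - tri v a b.
Proof. exact: dot_crossC. Qed.

Lemma next_inj v : injective (next v).
Proof.
move=> a a' e.
have [va|nva] := boolP (adj v a); have [va'|nva'] := boolP (adj v a').
- have [vb ab t] := nextP va; have [_ a'b t'] := nextP va'; rewrite -e in a'b t'.
  apply: (tri_inj vb) => //; try by rewrite adjC.
  rewrite ![tri v (next v a) _]tri_swap; congr (- _).
  by apply/eqP; rewrite -(@eqrXn2 _ 2) ?ltW // !tri_sq.
- have [vb _ _] := nextP va; move: vb; rewrite e {1}/next (negPf nva').
  by rewrite (negPf nva').
- have [vb _ _] := nextP va'; move: vb; rewrite -e {1}/next (negPf nva).
  by rewrite (negPf nva).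
- by move: e; rewrite /next (negPf nva) (negPf nva').
Qed.

Let k := c / (1 + c).

(** Three consecutive neighbours [a], [b], [e] of [v]: both [a + e] and
    [2 * k * (v + b)] are symmetric in the mirror through [v] and [b]. *)
Lemma next_rec v a : adj v a ->
  p (next v (next v a)) = (2 * k) *: (p v + p (next v a)) - p a.
Proof.
move=> va; have [vb ab t1] := nextP va; set b := next v a in vb ab t1 *.
have [ve be t2] := nextP vb; set e := next v b in ve be t2 *.
have [cm c1] := andP (apexes_bounds va).
have ba : adj b a by rewrite adjC.
have kc : k * (1 + c) = c by rewrite /k divfK //; lra.
pose w := p e - ((2 * k) *: (p v + p b) - p a).
have wv : dot w (p v) = 0.
  rewrite /w !dot_linear p_unit !(dotC _ (p v)) !adj_dot //; nra.
have wb : dot w (p b) = 0.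
  rewrite /w !dot_linear p_unit !(dotC _ (p b)) (dotC (p b) (p v)) !adj_dot //; nra.
have wn : dot w (cross (p v) (p b)) = 0.
  rewrite /w !dot_linear dot_crossl dot_crossr.
  have te : dot (p e) (cross (p v) (p b)) = tri v b e by rewrite cross_rot.
  have ta : dot (p a) (cross (p v) (p b)) = - tri v a b.
    by rewrite -tri_swap cross_rot.
  have tb : tri v b e = tri v a b.
    by apply/eqP; rewrite -(@eqrXn2 _ 2) ?ltW // !tri_sq.
  by rewrite te ta tb; ring.
have := ortho_parallel w wv wb; rewrite wn mul0r => /eqP.
rewrite mulf_eq0 dot_cross_cross !p_unit (dotC (p b)) !adj_dot // mulr1.
rewrite (negPf (apexes_neq0 va)) /=.
by rewrite dot_eq0 subr_eq0 => /eqP.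
Qed.

Lemma adj_iter v a (i : nat) : adj v a -> adj v (iter i (next v) a).
Proof. by move=> va; elim: i => [|i IH] //=; case: (nextP IH). Qed.

(** The recurrence of [next_rec], multiplied by the first neighbour: a state is
    a pair of consecutive scalar products. *)
Definition step (d : R * R) : R * R := (d.2, 2 * k * (c + d.2) - d.1).

(** The right-hand side does not mention [v] and [a]: all the turns look the
    same. *)
Lemma iter_next_dot v a (i : nat) : adj v a ->
  (dot (p a) (p (iter i (next v) a)), dot (p a) (p (iter i.+1 (next v) a))) =
  iter i step (1, c).
Proof.
move=> va; elim: i => [|i IH].
  by rewrite /= p_unit; have [_ /adj_dot -> _] := nextP va.
rewrite [RHS]iterS -IH /step /=; congr (_, _).
rewrite next_rec ?adj_iter // !dot_linear (dotC (p a) (p v)) adj_dot //; ring.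
Qed.

(** The turn closes up when the scalar product returns to [1], which happens at
    the same time for all [v] and [a]. *)
Lemma iter_next_eq v a (i : nat) : adj v a ->
  (iter i (next v) a == a) = ((iter i step (1, c)).1 == 1).
Proof.
move=> va; rewrite -(iter_next_dot i va) /=.
apply/eqP/eqP => [->|e]; first exact: p_unit.
apply/eqP; apply: contraT; rewrite eq_sym -(p_neq p_inj) => ne.
by have := dot_unit_lt1 (p_unit _) (p_unit _) ne; rewrite e ltxx.
Qed.

Lemma order_next_le v a w b : adj v a -> adj w b ->
  (order (next v) a <= order (next w) b)%N.
Proof.
move=> va wb; rewrite leqNgt; apply/negP => lt.
have : iter (order (next w) b) (next v) a == a.
  by rewrite iter_next_eq // -(iter_next_eq _ wb) iter_order //; exact: next_inj.
move=> /eqP e; have := findex_iter lt; rewrite e findex0 => o0.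
by have := order_gt0 (next w) b; rewrite -o0.
Qed.

Lemma order_next v a w b : adj v a -> adj w b ->
  order (next v) a = order (next w) b.
Proof. by move=> va wb; apply/eqP; rewrite eqn_leq !order_next_le. Qed.

(** A turn cannot close up after one step, since contacts join distinct points,
    nor after two: the triangles [v a b] and [v b a] have opposite
    orientations. *)
Lemma order_next_gt2 v a : adj v a -> (2 < order (next v) a)%N.
Proof.
move=> va; have := order_gt0 (next v) a; have := iter_order (@next_inj v) a.
case: (order _ _) => [|[|[|n]]] //= e _.
- by have [_ /andP[/eqP ne _] _] := nextP va; case: ne; rewrite e.
- have [vb _ t] := nextP va; have [_ _] := nextP vb; rewrite e tri_swap.
  by rewrite oppr_gt0 ltNge ltW.
Qed.

(** The neighbours of [v] form one orbit: each orbit has at least three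
    elements, and there are at most five neighbours. *)
Lemma degree_order v a : adj v a -> degree v = order (next v) a.
Proof.
move=> va; have sub b : adj v b -> fconnect (next v) b \subset [set x | adj v x].
  move=> vb; apply/fintype.subsetP => x /iter_findex <-.
  by rewrite inE adj_iter.
apply/eqP; rewrite eqn_leq andbC subset_leq_card ?sub //=.
apply/subset_leq_card/fintype.subsetP => b; rewrite inE => vb.
apply: contraT => nab.
have dis : [disjoint fconnect (next v) a & fconnect (next v) b].
  apply/pred0P => x /=; apply/negP => /andP[ax bx].
  case/negP: nab; apply: connect_trans ax _.
  by rewrite (fconnect_sym (@next_inj v)).
have := degree_le5 v.
have : (order (next v) a + order (next v) b <= degree v)%N.
  rewrite /order -cardUI (eqP dis) addn0; apply/subset_leq_card/fintype.subsetP.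
  by move=> x /orP[]; apply/fintype.subsetP; apply: sub.
have := order_next_gt2 va; have := order_next_gt2 vb.
lia.
Qed.

End Turning.

End Rotation.

(** * The bound and its equality case *)

Section Bound.
Variables (R : realType) (c : R).

Lemma coplanar_contacts (T : finType) (p : T -> 'rV[R]_3) :
  injective p -> (forall i, dot (p i) (p i) = 1) ->
  coplanar p -> (\sum_x degree p c x <= 2 * #|T|)%N.
Proof.
move=> p_inj p_unit [u [m [u0 um]]].
rewrite mulnC -sum_nat_const; apply: leq_sum => x _.
apply: leq_trans (plane_contacts c p_inj p_unit u0 (um x)).
by apply/subset_leq_card/fintype.subsetP => y; rewrite !inE um eqxx andbT.
Qed.

Lemma degree_sum_bound (T : finType) (p : T -> 'rV[R]_3) :
  injective p -> (forall i, dot (p i) (p i) = 1) ->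
  (forall i j, i != j -> dot (p i) (p j) <= c) -> (2 < #|T|)%N ->
  (\sum_x degree p c x <= 6 * (#|T| - 2))%N.
Proof.
move=> p_inj p_unit p_le T2; have [cop|ncop] := pselect (coplanar p).
  by apply: leq_trans (coplanar_contacts p_inj p_unit cop) _; lia.
exact: contacts_bound.
Qed.

(** Deleting an isolated point keeps all the contacts, but lowers the bound. *)
Lemma bound_attained_degree (T : finType) (p : T -> 'rV[R]_3) v :
  injective p -> (forall i, dot (p i) (p i) = 1) ->
  (forall i j, i != j -> dot (p i) (p j) <= c) -> (3 < #|T|)%N ->
  (6 * (#|T| - 2) <= \sum_x degree p c x)%N -> (0 < degree p c v)%N.
Proof.
move=> p_inj p_unit p_le T3 eqD; rewrite lt0n; apply/eqP => d0.
have nadj x : adj p c v x = false.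
  by have /setP/(_ x) := cards0_eq d0; rewrite !inE.
pose T' : finType := {x : T | x != v}.
have T'E : #|T'| = (#|T| - 1)%N.
  by rewrite card_sig subn1 -(cardC1 v); apply: eq_card.
pose p' (x : T') := p (val x).
have p'_inj : injective p' by move=> x y /p_inj/val_inj.
have := @degree_sum_bound T' p' p'_inj (fun x => p_unit _) _ _.
move=> /(_ (fun i j ij => p_le _ _ ij)); rewrite T'E.
have <- : (\sum_x degree p c x = \sum_x degree p' c x)%N.
  rewrite (bigD1 v) //= d0 add0n (@reindex_omap _ _ _ _ T' val insub) /=; last first.
    by move=> x xv; rewrite insubT.
  apply: eq_big => [x|x _]; first by rewrite (valP x) valK eqxx.
  rewrite /degree -(card_imset _ val_inj); apply: eq_card => y.
  apply/idP/imsetP => [|[y' + ->]]; last by rewrite !inE.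
  rewrite inE => xy; have yv : y != v.
    by apply: contraTneq xy => ->; rewrite adjC nadj.
  by exists (Sub y yv) => //; rewrite inE.
move=> bound; have T2 : (2 < #|T| - 1)%N by lia.
by have := bound T2; lia.
Qed.

Lemma bound_attained_card (T : finType) (p : T -> 'rV[R]_3) :
  injective p -> (forall i, dot (p i) (p i) = 1) ->
  (forall i j, i != j -> dot (p i) (p j) <= c) -> (2 < #|T|)%N ->
  (6 * (#|T| - 2) <= \sum_x degree p c x)%N -> #|T| \in [:: 3; 4; 6; 12]%N.
Proof.
move=> p_inj p_unit p_le T2 eqD; have [T3|T3] := leqP #|T| 3.
  by have -> : #|T| = 3 by lia.
have [cop|ncop] := pselect (coplanar p).
  by have := coplanar_contacts p_inj p_unit cop; lia.
have apexes x y (xy : adj p c x y) :=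
  bound_attained_edges p_inj p_unit p_le T2 ncop eqD xy.
have nbr v : exists a, adj p c v a.
  have /card_gt0P[a] := bound_attained_degree v p_inj p_unit p_le T3 eqD.
  by rewrite inE; exists a.
have /card_gt0P[v0 _] : (0 < #|T|)%N by lia.
have [a0 va0] := nbr v0.
have degE v : degree p c v = degree p c v0.
  have [a va] := nbr v.
  rewrite (degree_order p_inj p_unit p_le apexes va).
  rewrite (degree_order p_inj p_unit p_le apexes va0).
  exact: order_next.
have gt2 : (2 < degree p c v0)%N.
  by rewrite (degree_order p_inj p_unit p_le apexes va0) order_next_gt2.
have le5 := degree_le5 p_inj p_unit p_le v0.
have le := degree_sum_bound p_inj p_unit p_le T2.
have sumE : (\sum_x degree p c x = #|T| * degree p c v0)%N.
  by rewrite -sum_nat_const; apply: eq_bigr => v _; exact: degE.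
rewrite sumE in le eqD.
move: gt2 le5 le eqD; case: (degree p c v0) => [|[|[|[|[|[|//]]]]]] // _ _ le eqD.
- by have -> : #|T| = 4 by lia.
- by have -> : #|T| = 6 by lia.
- by have -> : #|T| = 12 by lia.
Qed.

End Bound.

(** * Contact numbers of configurations *)

Section Bridge.
Variables (R : realType) (T : finType) (p : T -> 'rV[R]_3) (c : R).
Variable X : {fset 'rV[R]_3}.
Implicit Types (i j : T).
Hypothesis p_inj : injective p.
Hypothesis p_unit : forall i, dot (p i) (p i) = 1.
Hypothesis p_le : forall i j, i != j -> dot (p i) (p j) <= c.
Hypothesis Xp : forall x, reflect (exists i, x = p i) (x \in X).
Local Notation adj := (adj p c).

Lemma dot_itv i j : dot (p i) (p j) \in `[-1, 1].
Proof.
have := dot_ge0 (p i + p j); have := dot_ge0 (p i - p j).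
rewrite !dotDl !dotDr !dotNl !dotNr !p_unit (dotC (p j) (p i)) in_itv /=.
by move=> ? ?; apply/andP; split; lra.
Qed.

Lemma le_acos (a b : R) : a \in `[-1, 1] -> b \in `[-1, 1] -> a <= b ->
  acos b <= acos a.
Proof.
move=> a1 b1; apply: contraTT; rewrite -!ltNge.
have acos_itv t : t \in `[-1, 1] -> acos t \in `[0, @pi R].
  by rewrite !in_itv /= => t1; rewrite acos_ge0 ?acos_lepi.
by rewrite -ltr_cos ?acos_itv // !acosK.
Qed.

(** The arc cosine is decreasing, so the smallest angular distance corresponds to
    the largest scalar product. *)
Lemma contact_psi i0 j0 : adj i0 j0 ->
  forall i j, i != j -> (adist (p i) (p j) == psi X) = (dot (p i) (p j) == c).
Proof.
move=> /andP[ij0 /eqP c0].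
have X1 : (1 < #|` X|)%N.
  rewrite (cardfsD1 (p i0)) (cardfsD1 (p j0)) !inE (eq_sym (p j0)) p_neq //.
  have -> : p i0 \in X by apply/Xp; exists i0.
  have -> : p j0 \in X by apply/Xp; exists j0.
  by rewrite ij0.
have XS : ([set` X] `<=` @sphere R)%classic by move=> x /= /Xp[i ->]; exact: p_unit.
have psiE : psi X = acos c.
  apply/le_anti/andP; split.
    rewrite -c0; apply: psi_le; last by rewrite (p_neq p_inj).
    - by apply/Xp; exists i0.
    - by apply/Xp; exists j0.
  have [_ [_ [/Xp[k ->] /Xp[l ->] kl <-]]] := psi_attained XS X1.
  rewrite (p_neq p_inj) in kl.
  by apply: le_acos; rewrite -?c0 ?dot_itv // c0 p_le.
move=> i j ij; rewrite psiE /adist -c0.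
by rewrite (inj_in_eq (can_in_inj (@acosK R))) ?dot_itv.
Qed.

(** A contact is counted once by orienting it along an enumeration of the
    points, and twice by the degrees. *)
Lemma num_contacts_degree : (exists i j, adj i j) ->
  (\sum_i degree p c i = 2 * num_contacts X)%N.
Proof.
move=> [i0 [j0 ij0]].
pose lt i j := (enum_rank i < enum_rank j)%N.
pose P := [set ij : T * T | adj ij.1 ij.2 && lt ij.1 ij.2].
have lt_total i j : i != j -> lt i j = ~~ lt j i.
  move=> ij; rewrite /lt ltnNge leq_eqVlt; case: eqP => //= e.
  by case/eqP: ij; apply: enum_rank_inj; apply: val_inj.
pose g (ij : T * T) := [fset p ij.1; p ij.2]%fset.
have -> : num_contacts X = #|P|.
  rewrite /num_contacts; have -> : contact_pairs X = [fset g ij | ij in P]%fset.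
    apply/fsetP => A; rewrite !inE /=; apply/andP/imfsetP => /=.
    - move=> [AX /asboolP[x [y [xy AE axy]]]].
      have /Xp[i xi] : x \in X.
        by move: AX; rewrite fpowersetE => /fsubsetP; apply; rewrite AE !inE eqxx.
      have /Xp[j yj] : y \in X.
        by move: AX; rewrite fpowersetE => /fsubsetP; apply; rewrite AE !inE eqxx orbT.
      have ij : i != j by rewrite -(p_neq p_inj) -xi -yj.
      have aij : adj i j.
        by rewrite adjE ij -(contact_psi ij0 ij) -xi -yj; apply/eqP.
      have [l|l] := boolP (lt i j).
        by exists (i, j); rewrite ?inE /= ?aij // AE xi yj.
      exists (j, i); first by rewrite inE /= adjC aij /= lt_total // eq_sym.
      by rewrite AE xi yj /g /= fsetUC.
    - move=> [[i j]]; rewrite inE /= => /andP[ij _] ->; split.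
        rewrite fpowersetE; apply/fsubsetP => x; rewrite !inE.
        by case/orP => /eqP ->; apply/Xp; [exists i|exists j].
      apply/asboolP; exists (p i), (p j); split => //.
        by rewrite (p_neq p_inj); case/andP: ij.
      by apply/eqP; rewrite (contact_psi ij0) //; case/andP: ij.
  rewrite card_in_imfset /= ?cardE //.
  move=> [i j] [i' j']; rewrite !inE /= => /andP[ij l] /andP[i'j' l'] e.
  have : p i \in g (i', j') by rewrite -e !inE eqxx.
  have : p j \in g (i', j') by rewrite -e !inE eqxx orbT.
  rewrite !inE /= !(inj_eq p_inj) => /orP[]/eqP jE /orP[]/eqP iE; subst => //.
  - by case/andP: ij; rewrite eqxx.
  - by move: l'; rewrite lt_total ?l //; case/andP: i'j'.
  - by case/andP: ij; rewrite eqxx.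
have -> : #|P| = (\sum_i #|[set j | adj i j && lt i j]|)%N.
  rewrite -sum1dep_card; under [RHS]eq_bigr do rewrite -sum1dep_card.
  by rewrite pair_big_dep.
rewrite mul2n -addnn.
have {2}-> : (\sum_i #|[set j | adj i j && lt i j]| =
              \sum_i #|[set j | adj i j && lt j i]|)%N.
  under eq_bigr do rewrite -sum1dep_card.
  under [RHS]eq_bigr do rewrite -sum1dep_card.
  rewrite (exchange_big_dep predT) //=; apply: eq_bigr => j _.
  by apply: eq_bigl => i; rewrite adjC.
rewrite -big_split /=; apply: eq_bigr => i _.
rewrite /degree -(cardsID [set j | lt i j]); congr (_ + _)%N.
  by apply: eq_card => j; rewrite !inE.
apply: eq_card => j; rewrite !inE; case ij: (adj i j); rewrite ?andbF //= andbT.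
by rewrite lt_total ?negbK //; case/andP: ij.
Qed.

End Bridge.

Lemma minimal_distance (R : realType) (X : {fset 'rV[R]_3}) :
  ([set` X] `<=` @sphere R)%classic -> (1 < #|` X|)%N ->
  exists c, (forall i j : X, i != j -> dot (val i) (val j) <= c) /\
            exists i j : X, adj (fun i : X => val i) c i j.
Proof.
move=> XS X1; have [x [y [xX yX xy psiE]]] := psi_attained XS X1.
have unit (i : X) : dot (val i) (val i) = 1 by exact: XS (valP i).
have itv (i j : X) := dot_itv unit i j.
exists (dot x y); split; last first.
  by exists [` xX]%fset, [` yX]%fset; rewrite /adj /= eqxx andbT.
move=> i j ij; rewrite leNgt; apply/negP => lt.
have := psi_le (valP i) (valP j) ij; rewrite -psiE /adist => le1.
have xyi : dot x y \in `[-1, 1] := itv [` xX]%fset [` yX]%fset.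
have le2 := le_acos xyi (itv i j) (ltW lt).
have e : acos (dot x y) = acos (dot (val i) (val j)) by apply/le_anti/andP.
by move: lt; rewrite ((can_in_inj (@acosK R)) _ _ xyi (itv i j) e) ltxx.
Qed.

(** * Extremal configurations *)

Section MaxContacts.
Variable R : realType.

Lemma max_contacts_attained N :
  exists X : {fset 'rV[R]_3}, configuration N X /\ num_contacts X = max_contacts R N.
Proof.
by rewrite /max_contacts; case: ex_maxnP => k /asboolP.
Qed.

Lemma max_contacts_ge N (X : {fset 'rV[R]_3}) :
  configuration N X -> (num_contacts X <= max_contacts R N)%N.
Proof.
rewrite /max_contacts; case: ex_maxnP => k _ kmax XN.
by apply: kmax; apply/asboolP; exists X.
Qed.

(** The contact graph can be given by any relation [A] that implies contact;
    [s] is a list on which the degrees of [A] can be evaluated. *)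
Lemma max_contacts_example (T : finType) (p : T -> 'rV[R]_3) (c : R)
    (A : rel T) (s : seq T) (d : nat) :
  c < 1 -> (forall i, dot (p i) (p i) = 1) ->
  (forall i j, i != j -> dot (p i) (p j) <= c) ->
  (forall i j, A i j -> i != j /\ dot (p i) (p j) = c) ->
  uniq s -> (forall i, d <= count (A i) s)%N ->
  (2 < #|T|)%N -> (#|T| * d = 6 * (#|T| - 2))%N ->
  (3 * #|T| - 6 <= max_contacts R #|T|)%N.
Proof.
move=> c1 p_unit p_le Ac us As T2 Td.
have p_inj : injective p.
  move=> i j e; apply/eqP; apply: contraT => /p_le.
  by rewrite e p_unit leNgt c1.
have deg i : (d <= degree p c i)%N.
  apply: leq_trans (As i) _; rewrite -size_filter /degree cardE.
  apply: uniq_leq_size; first exact: filter_uniq.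
  move=> j; rewrite mem_filter mem_enum inE => /andP[/Ac[ij dij] _].
  by rewrite /adj ij dij eqxx.
pose X := [fset p i | i in T]%fset.
have Xp x : reflect (exists i, x = p i) (x \in X).
  by apply: (iffP (imfsetP _ _ _ _)) => /= [[i _ ->]|[i ->]]; exists i.
have XT : configuration #|T| X.
  split; first by move=> x /= /Xp[i ->]; exact: p_unit.
  by rewrite card_imfset //= -cardE.
apply: leq_trans (max_contacts_ge XT).
have : (#|T| * d <= \sum_i degree p c i)%N by rewrite -sum_nat_const leq_sum.
rewrite (num_contacts_degree p_inj p_unit p_le Xp); first lia.
have /card_gt0P[i _] : (0 < #|T|)%N by lia.
have : (0 < degree p c i)%N.
  apply: leq_trans (deg i); have : (0 < #|T| * d)%N by lia.
  by rewrite muln_gt0 => /andP[].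
by move=> /card_gt0P[j]; rewrite inE => ij; exists i, j.
Qed.

(** Three orthogonal unit vectors. *)
Definition axis (k : option bool) : 'rV[R]_3 :=
  match k with
  | None => vec3 1 0 0 | Some false => vec3 0 1 0 | Some true => vec3 0 0 1
  end.

Definition axes : seq (option bool) := [:: None; Some false; Some true].

Lemma dot_axis k l : dot (axis k) (axis l) = (k == l)%:R.
Proof. by case: k => [[]|]; case: l => [[]|]; rewrite !coordE /=; ring. Qed.

Definition sg (b : bool) : R := if b then 1 else -1.

Lemma sg_sqr b : sg b * sg b = 1.
Proof. by case: b; rewrite /sg; ring. Qed.

Lemma max_contacts3 : (3 <= max_contacts R 3)%N.
Proof.
have T3 : #|{: option bool}| = 3 by rewrite card_option card_bool.
have := @max_contacts_example (option bool) axis 0 (fun k l => k != l) axes 2.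
rewrite T3; apply => //.
- by move=> k; rewrite dot_axis eqxx.
- by move=> k l kl; rewrite dot_axis (negPf kl).
- by move=> k l kl; rewrite dot_axis (negPf kl).
- by move=> [[]|].
Qed.

(** The regular tetrahedron, as alternate vertices of a cube. *)
Lemma max_contacts4 : (6 <= max_contacts R 4)%N.
Proof.
pose r : R := Num.sqrt (1 / 3).
have r2 : r * r = 1 / 3 by rewrite -expr2 sqr_sqrtr // divr_ge0.
pose p (ab : bool * bool) : 'rV[R]_3 :=
  r *: vec3 (sg ab.1) (sg ab.2) (sg ab.1 * sg ab.2).
have pE i j : dot (p i) (p j) = if i == j then 1 else - (1 / 3).
  rewrite /p dotZl dotZr mulrA r2 !coordE.
  by move: i j => [[] []] [[] []]; rewrite /sg /=; field.
have := @max_contacts_example _ p (- (1 / 3)) (fun k l => k != l)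
  [:: (true, true); (true, false); (false, true); (false, false)] 3.
have T4 : #|{: bool * bool}| = 4 by rewrite card_prod card_bool.
rewrite {}T4; apply => //.
- by move=> i; rewrite pE eqxx.
- by move=> i j ij; rewrite pE (negPf ij).
- by move=> i j ij; rewrite pE (negPf ij).
- by move=> [[] []].
Qed.

(** The regular octahedron. *)
Lemma max_contacts6 : (12 <= max_contacts R 6)%N.
Proof.
pose T : finType := (option bool * bool)%type.
pose p (ka : T) : 'rV[R]_3 := sg ka.2 *: axis ka.1.
have pE i j : dot (p i) (p j) = sg i.2 * sg j.2 * (i.1 == j.1)%:R.
  by rewrite /p dotZl dotZr mulrA dot_axis.
have := @max_contacts_example T p 0 (fun i j => i.1 != j.1)
  [seq (k, b) | k <- axes, b <- [:: true; false]] 4.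
have T6 : #|{: T}| = 6 by rewrite card_prod card_option card_bool.
rewrite {}T6; apply => //.
- by move=> i; rewrite pE sg_sqr eqxx mulr1.
- move=> [k a] [l b] ij; rewrite pE /=; have [kl|_] := eqVneq k l; last by rewrite mulr0.
  move: ij; rewrite kl; case: a; case: b; rewrite ?eqxx // /sg /= => _; lra.
- move=> [k a] [l b] /= kl; split; first by apply: contraNneq kl => -[-> _].
  by rewrite pE /= (negPf kl) mulr0.
- by move=> [[[]|] []].
Qed.

Definition axis_succ (k : option bool) : option bool :=
  match k with
  | None => Some false | Some false => Some true | Some true => None
  end.

(** The regular icosahedron: the vertices are the cyclic permutations of
    [(0, 1, phi)] with all signs, where [phi] is the golden ratio, divided by
    their length, which is the square root of [2 + phi]. *)
Lemma max_contacts12 : (30 <= max_contacts R 12)%N.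
Proof.
pose T : finType := (option bool * bool * bool)%type.
pose phi : R := (1 + Num.sqrt 5) / 2.
have s5 : Num.sqrt 5 ^+ 2 = 5 :> R by rewrite sqr_sqrtr.
have s0 : 0 <= Num.sqrt 5 :> R by exact: sqrtr_ge0.
have phi0 : 0 < phi by rewrite /phi; lra.
have phi2 : phi * phi = phi + 1 by rewrite /phi; nra.
pose r : R := Num.sqrt ((2 + phi)^-1).
have r2 : r * r = (2 + phi)^-1.
  by rewrite -expr2 sqr_sqrtr // invr_ge0; lra.
pose q (i : T) : 'rV[R]_3 :=
  sg i.1.2 *: axis (axis_succ i.1.1) +
  (sg i.2 * phi) *: axis (axis_succ (axis_succ i.1.1)).
pose p (i : T) : 'rV[R]_3 := r *: q i.
(* The four vertices with one first index form a rectangle, whose short sides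
   are edges; a vertex is also joined to the nearer two vertices of each of the
   other two rectangles. *)
pose A (i j : T) : bool :=
  if i.1.1 == j.1.1 then (i.1.2 != j.1.2) && (i.2 == j.2)
  else if axis_succ i.1.1 == j.1.1 then i.2 == j.1.2 else i.1.2 == j.2.
have pE i j : dot (p i) (p j) = dot (q i) (q j) / (2 + phi).
  by rewrite /p dotZl dotZr mulrA r2 mulrC.
have qE i j : dot (q i) (q j) =
    if i == j then 2 + phi else if A i j then phi else
    if i.1.1 == j.1.1 then if i.2 == j.2 then phi else
       if i.1.2 == j.1.2 then - phi else - 2 - phi else - phi.
  rewrite /q !dot_linear !dot_axis.
  by move: i j => [[[[]|] []] []] [[[[]|] []] []]; rewrite /A /sg /=; nra.
have den0 : 0 < 2 + phi by lra.
have := @max_contacts_example T p (phi / (2 + phi)) A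
  [seq (k, b) | k <- [seq (k, a) | k <- axes, a <- [:: true; false]],
                b <- [:: true; false]] 5.
have T12 : #|{: T}| = 12 by rewrite !card_prod card_option card_bool.
rewrite {}T12; apply => //.
- by rewrite ltr_pdivrMr //; lra.
- by move=> i; rewrite pE qE eqxx divff // gt_eqF.
- move=> i j ij; rewrite pE ler_pM2r ?invr_gt0 // qE (negPf ij).
  by do 4?case: ifP => _ //; lra.
- move=> i j ij; have ne : i != j.
    by apply: contraTneq ij => ->; rewrite /A !eqxx.
  by rewrite pE qE (negPf ne) ij.
- by move=> [[[[]|] []] []].
Qed.

End MaxContacts.

Theorem mainTheorem3 (R : realType) (N : nat) (hN : (2 < N)%N) :
  (max_contacts R N <= 3 * N - 6)%N /\
  (max_contacts R N = (3 * N - 6)%N <-> N \in [:: 3; 4; 6; 12]%N).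
Proof.
have [X [XN KE]] := max_contacts_attained R N; have [XS cardX] := XN.
pose p (i : X) : 'rV[R]_3 := val i.
have p_inj : injective p by exact: val_inj.
have p_unit i : dot (p i) (p i) = 1 by exact: XS (valP i).
have [|c [p_le ex]] := minimal_distance XS; first by rewrite cardX ltnW.
have Xp x : reflect (exists i, x = p i) (x \in X).
  by apply: (iffP idP) => [xX|[i ->]]; [exists [` xX]%fset|exact: valP].
have T2 : (2 < #|{: X}|)%N by rewrite -cardfE cardX.
have D := num_contacts_degree p_inj p_unit p_le Xp ex.
have le := degree_sum_bound p_inj p_unit p_le T2.
have att := bound_attained_card p_inj p_unit p_le T2.
rewrite D KE -cardfE cardX in le att.
have bound : (max_contacts R N <= 3 * N - 6)%N by lia.
split=> //; split=> [eqK|]; first by apply: att; lia.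
rewrite !inE => /or4P[] /eqP NE; apply/eqP; rewrite eqn_leq bound NE.
- exact: max_contacts3.
- exact: max_contacts4.
- exact: max_contacts6.
- exact: max_contacts12.
Qed.
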